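(* Let $k\geq 1$. The generating function of the cube polynomials $C_{M_{n,k}}(x)$ of the Munarini graphs is $$\sum_{n\geq 0} C_{M_{n,k}}(x)\,t^n=\frac{1}{1-kt-(k-1)xt-(1+x)t^2}$$ as formal power series in $t$ with coefficients in $\mathbb{Z}[x]$.
   Context: For integers $k\geq 1$, $n\geq 0$, a $k$-generalized Pell string of length $n$ is a word of length $n$ over the alphabet $\{0,1,\ldots,k\}$ in which every maximal run of the character $k$ has even length (equivalently, a concatenation of letters from $\{0,1,\ldots,k-1,kk\}$). Let $\mathcal{F}_{n,k}$ be the set of these strings (for $n=0$ it contains only the empty string). The Munarini graph $M_{n,k}$ is the simple graph with vertex set $\mathcal{F}_{n,k}$ in which two vertices are adjacent if one of them can be obtained from the other either by replacing one occurrence of $0$ with some $i\in\{1,\ldots,k-1\}$, or by replacing one substring $00$ (two consecutive positions) with $kk$ (both replacements may be read in either direction, and both strings must be in $\mathcal{F}_{n,k}$). For a finite graph $G$, the cube polynomial is $C_G(x)=\sum_{p\geq 0}c_p(G)x^p$, where $c_p(G)$ is the number of induced subgraphs of $G$ isomorphic to the $p$-dimensional hypercube $Q_p$ ($Q_0=K_1$). *)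

(* Defs.v *)
From HB Require Import structures.
From mathcomp Require Import all_boot all_order all_algebra.
From mathcomp Require Import boolp.

Set Implicit Arguments.
Unset Strict Implicit.
Unset Printing Implicit Defensive.

Import GRing.Theory.
Local Open Scope ring_scope.

Record fps (R : Type) := FPS { fps_coef : nat -> R }.

HB.instance Definition _ (R : Type) := gen_eqMixin (fps R).
HB.instance Definition _ (R : Type) := gen_choiceMixin (fps R).

Lemma fpsP (R : Type) (f g : fps R) :
  (forall n, fps_coef f n = fps_coef g n) <-> f = g.
Proof.
split=> [|-> //]; case: f g => [f] [g] /= fg.
by congr FPS; apply: funext.
Qed.

Section FpsZmod.
Variable R : zmodType.
Implicit Types f g h : fps R.

Definition fps_zero : fps R := FPS (fun=> 0).
Definition fps_opp f : fps R := FPS (fun n => - fps_coef f n).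
Definition fps_add f g : fps R := FPS (fun n => fps_coef f n + fps_coef g n).

Fact fps_addA : associative fps_add.
Proof. by move=> f g h; apply/fpsP => n /=; rewrite addrA. Qed.
Fact fps_addC : commutative fps_add.
Proof. by move=> f g; apply/fpsP => n /=; rewrite addrC. Qed.
Fact fps_add0 : left_id fps_zero fps_add.
Proof. by move=> f; apply/fpsP => n /=; rewrite add0r. Qed.
Fact fps_addN : left_inverse fps_zero fps_opp fps_add.
Proof. by move=> f; apply/fpsP => n /=; rewrite addNr. Qed.

HB.instance Definition _ :=
  GRing.isZmodule.Build (fps R) fps_addA fps_addC fps_add0 fps_addN.
End FpsZmod.

Section FpsRing.
Variable R : comNzRingType.
Implicit Types f g h : fps R.

Definition fpsC (c : R) : fps R := FPS (fun n => if n == 0%N then c else 0).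
Definition fpsX : fps R := FPS (fun n => (n == 1%N)%:R).
Definition fps_mul f g : fps R :=
  FPS (fun n => \sum_(i < n.+1) fps_coef f i * fps_coef g (n - i)).

Let trunc N f : {poly R} := \poly_(i < N) fps_coef f i.

Let coef_mul N f g n : (n < N)%N ->
  fps_coef (fps_mul f g) n = (trunc N f * trunc N g)`_n.
Proof.
move=> ltnN; rewrite coefM; apply: eq_bigr => i _; rewrite !coef_poly.
by rewrite (leq_ltn_trans (leq_subr i n) ltnN) (leq_ltn_trans _ ltnN) // -ltnS.
Qed.

Fact fps_mulC : commutative fps_mul.
Proof. by move=> f g; apply/fpsP => n; rewrite !(coef_mul _ _ (ltnSn n)) mulrC. Qed.

Fact fps_mulA : associative fps_mul.
Proof.
move=> f g h; apply/fpsP => n; rewrite !(coef_mul _ _ (ltnSn n)).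
transitivity ((trunc n.+1 f * (trunc n.+1 g * trunc n.+1 h))`_n).
  rewrite !coefM; apply: eq_bigr => i _; congr (_ * _).
  by rewrite coef_poly ltnS leq_subr; apply: coef_mul; rewrite ltnS leq_subr.
rewrite mulrA !coefM; apply: eq_bigr => i _; congr (_ * _).
by rewrite [RHS]coef_poly ltn_ord; apply/esym/coef_mul.
Qed.

Fact fps_mul1 : left_id (fpsC 1) fps_mul.
Proof.
move=> f; apply/fpsP => n /=; rewrite big_ord_recl /= mul1r subn0.
by rewrite big1 ?addr0 // => i _; rewrite mul0r.
Qed.

Fact fps_mulDl : left_distributive fps_mul +%R.
Proof.
move=> f g h; apply/fpsP => n /=; rewrite -big_split /=.
by apply: eq_bigr => i _; rewrite mulrDl.
Qed.

Fact fps_oner_neq0 : fpsC 1 != 0.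
Proof. by apply/eqP => /fpsP/(_ 0%N)/eqP; rewrite /= oner_eq0. Qed.

HB.instance Definition _ := GRing.Zmodule_isComNzRing.Build (fps R)
  fps_mulA fps_mulC fps_mul1 fps_mulDl fps_oner_neq0.
End FpsRing.

Section FpsUnitRing.
Variable R : comUnitRingType.
Implicit Types f g h : fps R.

(* The first n coefficients of the inverse of f, obtained by solving
   \sum_(i <= m) g_i f_(m - i) = [m = 0] for g_m.                             *)
Fixpoint fps_inv_seq f (n : nat) : seq R :=
  if n is m.+1 then
    let s := fps_inv_seq f m in
    rcons s ((fps_coef f 0)^-1 *
             ((m == 0%N)%:R - \sum_(i < m) s`_i * fps_coef f (m - i)))
  else [::].

Definition fps_unit : pred (fps R) := fun f => fps_coef f 0 \is a GRing.unit.
Definition fps_inv f : fps R :=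
  if fps_unit f then FPS (fun n => (fps_inv_seq f n.+1)`_n) else f.

Let size_inv_seq f n : size (fps_inv_seq f n) = n.
Proof. by elim: n => //= n IHn; rewrite size_rcons IHn. Qed.

Let nth_inv_seq f n i : (i < n)%N ->
  (fps_inv_seq f n)`_i = (fps_inv_seq f i.+1)`_i.
Proof.
elim: n => // n IHn; rewrite ltnS leq_eqVlt => /predU1P[-> //|ltin].
by rewrite [LHS]/= nth_rcons size_inv_seq ltin IHn.
Qed.

Fact fps_mulVr : {in fps_unit, left_inverse 1 fps_inv *%R}.
Proof.
move=> f uf; have uf0 : fps_coef f 0 \is a GRing.unit by [].
apply/fpsP => n; rewrite /fps_inv [fps_unit f]uf /=.
rewrite big_ord_recr /= subnn nth_rcons size_inv_seq ltnn eqxx.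
rewrite mulrC mulVKr // addrC.
rewrite [X in _ - X](eq_bigr (fun i : 'I_n =>
  (fps_inv_seq f i.+1)`_i * fps_coef f (n - i))); last first.
  by move=> i _; rewrite nth_inv_seq.
by rewrite subrK; case: n.
Qed.

Fact fps_unitP f g : g * f = 1 -> fps_unit f.
Proof.
move=> /fpsP/(_ 0%N) /=; rewrite big_ord1 subnn => gf1.
by apply/unitrPr; exists (fps_coef g 0); rewrite mulrC.
Qed.

Fact fps_inv_out : {in [predC fps_unit], fps_inv =1 id}.
Proof. by move=> f /negbTE uf; rewrite /fps_inv [fps_unit f]uf. Qed.

HB.instance Definition _ := GRing.ComNzRing_hasMulInverse.Build (fps R)
  fps_mulVr fps_unitP fps_inv_out.
End FpsUnitRing.

Arguments fpsX {R}.

Definition cube_adj (p : nat) : rel {ffun 'I_p -> bool} :=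
  fun x y => #|[set i | x i != y i]| == 1%N.

Section CubePolynomial.
Variables (V : finType) (e : rel V).

Definition induces_cube (p : nat) (S : {set V}) : bool :=
  [exists f : {ffun {ffun 'I_p -> bool} -> V},
    [&& injectiveb f, f @: [set: {ffun 'I_p -> bool}] == S
      & [forall x, forall y, e (f x) (f y) == cube_adj x y]]].

(* Induced subgraphs are identified with their vertex sets.                   *)
Definition cube_count (p : nat) : nat := #|[set S | induces_cube p S]|.

Definition cube_poly : {poly int} :=
  \poly_(p < #|V|.+1) (cube_count p)%:R.

(* The truncation in cube_poly loses nothing.                                 *)
Lemma coef_cube_poly p : cube_poly`_p = (cube_count p)%:R.
Proof.
rewrite coef_poly; case: ltnP => // ltVp.
rewrite /cube_count (_ : [set S | _] = set0) ?cards0 //.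
apply/setP => S; rewrite !inE; apply/negbTE/negP => /existsP[f].
case/and3P => /injectiveP/leq_card; rewrite card_ffun card_bool card_ord.
by move=> le2pV; have := leq_trans (ltn_expl p (ltnSn 1)) le2pV; rewrite ltnNge ltnW.
Qed.
End CubePolynomial.

(* The positions i, ..., j - 1 of s form a maximal run of the letter a.       *)
Definition maximal_run (T : eqType) (a : T) (s : seq T) (i j : nat) : bool :=
  [&& (i < j <= size s)%N, all (pred1 a) (drop i (take j s)),
      (i == 0%N) || (onth s i.-1 != Some a) & onth s j != Some a].

(* The alphabet {0, ..., k} is 'I_k.+1, so the letter k is ord_max.           *)
Definition pell_string (n k : nat) (w : n.-tuple 'I_k.+1) : bool :=
  [forall i : 'I_n.+1, forall j : 'I_n.+1,
    maximal_run ord_max w i j ==> ~~ odd (j - i)].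

Definition munarini_vertex (n k : nat) : finType :=
  {w : n.-tuple 'I_k.+1 | pell_string w}.

Definition replace_letter (n k : nat) (u v : n.-tuple 'I_k.+1) : bool :=
  [exists i : 'I_n, exists a : 'I_k.+1,
    [&& (0 < a < k)%N, tnth u i == ord0 & val v == set_nth ord0 u i a]].

Definition replace_pair (n k : nat) (u v : n.-tuple 'I_k.+1) : bool :=
  [exists i : 'I_n, exists j : 'I_n,
    [&& j == i.+1 :> nat, tnth u i == ord0, tnth u j == ord0
      & val v == set_nth ord0 (set_nth ord0 u i ord_max) j ord_max]].

Definition munarini_adj (n k : nat) : rel (munarini_vertex n k) :=
  fun u v => [|| replace_letter (val u) (val v), replace_letter (val v) (val u),
                 replace_pair (val u) (val v) | replace_pair (val v) (val u)].

Lemma munarini_sym n k : symmetric (@munarini_adj n k).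
Proof. by move=> u v; rewrite /munarini_adj [replace_pair _ _ || _]orbC orbCA. Qed.

Lemma munarini_irrefl n k : (0 < k)%N -> irreflexive (@munarini_adj n k).
Proof.
move=> k_gt0 u; rewrite /munarini_adj !orbA !orbb -orbA orbb; apply/negbTE; rewrite negb_or.
apply/andP; split; apply/negP => /existsP[i] /existsP[a].
  case/and3P => /andP[a_gt0 _] /eqP ui /eqP/(congr1 (nth ord0 ^~ i)).
  rewrite nth_set_nth /= eqxx -tnth_nth ui => a0.
  by rewrite -a0 in a_gt0.
case/and4P => _ _ /eqP ua /eqP/(congr1 (nth ord0 ^~ a)).
rewrite nth_set_nth /= eqxx -tnth_nth ua => /(congr1 val) /= k0.
by rewrite -k0 in k_gt0.
Qed.

Definition munarini_cube_poly (n k : nat) : {poly int} :=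
  cube_poly (@munarini_adj n k).

(* Main.v *)
(** A Pell string is a word in the letters 0, ..., k - 1 and kk; it is determined
    by the set of its nonzero letters together with their positions. These sets
    form a simplicial complex and the edges of the Munarini graph are the pairs
    of faces differing by one element. In such a graph the opposite edges of a
    square change the same element, so the induced cubes are exactly the
    intervals [v \ B, v] with B a subset of the face v. Hence the cube
    polynomial is the sum of (1 + x)^|v| over all Pell strings v, and splitting
    off the first letter gives the recurrence
    C_(n+2) = (1 + (k - 1)(1 + x)) C_(n+1) + (1 + x) C_n. *)

Require Import Defs.
From mathcomp Require Import all_boot all_order all_algebra ring.

Set Implicit Arguments.
Unset Strict Implicit.
Unset Printing Implicit Defensive.

Import GRing.Theory.
Local Open Scope ring_scope.

(** * Coordinate flips of the hypercube *)

Definition flip p (x : {ffun 'I_p -> bool}) (i : 'I_p) : {ffun 'I_p -> bool} :=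
  [ffun j => x j (+) (j == i)].

Lemma cube_adj_flip p (x : {ffun 'I_p -> bool}) i : cube_adj x (flip x i).
Proof.
rewrite /cube_adj -[X in _ == X](cards1 i); apply/eqP.
congr #|pred_of_set _|; apply/setP => j.
by rewrite !inE ffunE; case: (x j); case: (j == i).
Qed.

Lemma flipC p (x : {ffun 'I_p -> bool}) i j : flip (flip x i) j = flip (flip x j) i.
Proof. by apply/ffunP => l; rewrite !ffunE addbAC. Qed.

Lemma flipK p (x : {ffun 'I_p -> bool}) i : flip (flip x i) i = x.
Proof. by apply/ffunP => l; rewrite !ffunE addbK. Qed.

Lemma flip_neq p (x : {ffun 'I_p -> bool}) i j : i != j -> flip x i <> flip x j.
Proof. by move=> ij /ffunP/(_ i); rewrite !ffunE eqxx (negbTE ij); case: (x i). Qed.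

(** * Induced cubes in the face graph of a simplicial complex *)

Section SimplicialCubes.

Variables (V T : finType) (e : rel V) (phi : V -> {set T}).
Hypothesis phi_inj : injective phi.
Hypothesis phi_down :
  forall v (B : {set T}), B \subset phi v -> exists u, phi u = B.
Hypothesis eP : forall u v,
  reflect (exists t, forall s, (s \in phi v) = (s \in phi u) (+) (s == t))
          (e u v).

Definition subcube (v : V) (B : {set T}) : {set V} :=
  [set u | (phi v :\: B \subset phi u) && (phi u \subset phi v)].

Lemma subcubeP v (B : {set T}) u : B \subset phi v ->
  reflect (forall t, t \notin B -> (t \in phi u) = (t \in phi v))
          (u \in subcube v B).
Proof.
move=> /subsetP sBv; rewrite inE; apply: (iffP andP).
  move=> [/subsetP h1 /subsetP h2] t tB.
  by apply/idP/idP => [/h2 //|tv]; apply: h1; rewrite inE tB.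
move=> h; split; apply/subsetP => t.
  by rewrite inE => /andP[tB tv]; rewrite h.
by move=> tu; have [/sBv //|tB] := boolP (t \in B); rewrite -h.
Qed.

(** The interval has largest face [phi v] and smallest face [phi v :\: B], and these two determine
    [v] and [B]. *)
Lemma subcube_inj v w (B C : {set T}) : B \subset phi v -> C \subset phi w ->
  subcube v B = subcube w C -> v = w /\ B = C.
Proof.
move=> Bv Cw eqS.
have [bv phi_bv] := phi_down (subsetDl (phi v) B).
have [bw phi_bw] := phi_down (subsetDl (phi w) C).
have vS : v \in subcube w C by rewrite -eqS inE subsetDl subxx.
have wS : w \in subcube v B by rewrite eqS inE subsetDl subxx.
have bvS : bv \in subcube w C by rewrite -eqS inE phi_bv subxx subsetDl.
have bwS : bw \in subcube v B by rewrite eqS inE phi_bw subxx subsetDl.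
move: vS wS bvS bwS; rewrite !inE => /andP[_ vw] /andP[_ wv].
have {vw wv} eq_vw : v = w by apply/phi_inj/eqP; rewrite eqEsubset vw.
rewrite phi_bv phi_bw -{}eq_vw in Cw * => /andP[s1 _] /andP[s2 _].
split=> //.
have /setP eqD : phi v :\: B = phi v :\: C by apply/eqP; rewrite eqEsubset s1 s2.
apply/setP => t; move: (eqD t); rewrite !inE.
move: (subsetP Bv t) (subsetP Cw t).
case: (t \in phi v); case: (t \in B); case: (t \in C) => //= h1 h2.
  by have := h1 isT.
by have := h2 isT.
Qed.

(** A 0/1 vector indexed by [B] selects the part of [B] to keep. The resulting face exists by
    downward closure, and two such faces differ in one element exactly when the vectors differ in
    one coordinate. *)
Lemma subcube_induces v (B : {set T}) :
  B \subset phi v -> induces_cube e #|B| (subcube v B).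
Proof.
move=> Bv; have sBv := subsetP Bv.
pose sel (x : {ffun 'I_#|B| -> bool}) : {set T} := [set enum_val i | i in [set i | x i]].
have selB x : sel x \subset B by apply/subsetP => _ /imsetP[i _ ->]; exact: enum_valP.
have selE x i : (enum_val i \in sel x) = x i.
  by rewrite mem_imset ?inE //; exact: enum_val_inj.
have sub x : (phi v :\: B) :|: sel x \subset phi v.
  by rewrite subUset subsetDl (subset_trans (selB x)).
have exF x : exists u, phi u == (phi v :\: B) :|: sel x.
  by have [u hu] := phi_down (sub x); exists u; rewrite hu.
pose f := [ffun x => xchoose (exF x)].
have fE x : phi (f x) = (phi v :\: B) :|: sel x.
  by rewrite ffunE; exact/eqP/(xchooseP (exF x)).
have memfB x i : (enum_val i \in phi (f x)) = x i.
  by rewrite fE !inE selE (enum_valP i).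
have memfN x t : t \notin B -> (t \in phi (f x)) = (t \in phi v).
  by move=> tB; rewrite fE !inE tB (contraNF (subsetP (selB x) t)) ?orbF.
apply/existsP; exists f; apply/and3P; split.
- apply/injectiveP => x y fxy; apply/ffunP => i.
  by rewrite -!memfB fxy.
- apply/eqP/setP => u; apply/imsetP/idP => [[x _ ->]|/(subcubeP _ Bv) hu].
    by apply/subcubeP => // t; exact: memfN.
  exists [ffun i => enum_val i \in phi u] => //; apply/phi_inj/setP => t.
  have [tB|tB] := boolP (t \in B); last by rewrite hu ?memfN.
  by rewrite -[t](enum_rankK_in tB) // memfB ffunE.
apply/forallP => x; apply/forallP => y; apply/eqP.
apply/eP/idP => [[t ht]|/cards1P[i /setP hi]].
  have tB : t \in B.
    by apply: contraT => tB; move: (ht t); rewrite !memfN // eqxx; case: (_ \in _).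
  apply/cards1P; exists (enum_rank_in tB t); apply/setP => i.
  rewrite !inE -[x i]memfB -[y i]memfB ht -[t in LHS](enum_rankK_in tB) //.
  by rewrite (inj_eq enum_val_inj); case: (i == _); case: (_ \in _).
exists (enum_val i) => s; have [sB|sB] := boolP (s \in B).
  rewrite -[s](enum_rankK_in sB) // !memfB (inj_eq enum_val_inj).
  by move: (hi (enum_rank_in sB s)); rewrite !inE => <-; case: (x _); case: (y _).
rewrite !memfN //; case: eqP => [se|]; last by rewrite addbF.
by rewrite se enum_valP in sB.
Qed.

(* The opposite edges of a square change the same element of T, so each
   coordinate direction of the cube is labelled by one element. *)
Lemma induces_subcube p S : induces_cube e p S ->
  exists v (B : {set T}), [/\ B \subset phi v, #|B| = p & S = subcube v B].
Proof.
case/existsP => f /and3P[/injectiveP f_inj /eqP <- /forallP fe].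
have ex_d x i : exists t,
    [forall s, (s \in phi (f (flip x i))) == (s \in phi (f x)) (+) (s == t)].
  have /eP[t ht] : e (f x) (f (flip x i)).
    by rewrite (eqP (forallP (fe x) _)) cube_adj_flip.
  by exists t; apply/forallP => s; rewrite ht.
pose d x i := xchoose (ex_d x i).
have dE x i s : (s \in phi (f (flip x i))) = (s \in phi (f x)) (+) (s == d x i).
  exact/eqP/(forallP (xchooseP (ex_d x i))).
have phif_inj x y : (forall s, (s \in phi (f x)) = (s \in phi (f y))) -> x = y.
  by move=> h; apply/f_inj/phi_inj/setP.
have d_inj x : injective (d x).
  move=> i j dij; apply/eqP/contraT => ij; case: (@flip_neq _ x _ _ ij).
  by apply: phif_inj => s; rewrite !dE dij.
have d_flip x i j : d (flip x j) i = d x i.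
  (* Both routes round the square from [x] produce the same total change of face. *)
  have sq s : (s == d x j) (+) (s == d (flip x j) i) =
      (s == d x i) (+) (s == d (flip x i) j).
    by apply: (@addbI (s \in phi (f x))); rewrite !addbA -!dE flipC.
  have [<-|ij] := eqVneq i j.
    apply/eqP/contraT => dd; move: (dE (flip x i) i (d x i)); rewrite flipK dE eqxx.
    by rewrite [d x i == _]eq_sym (negbTE dd); case: (_ \in _).
  have dij : d x i != d x j by rewrite (inj_eq (d_inj x)).
  have := sq (d x i); rewrite eqxx (negbTE dij) /=.
  have [<- //|ne /esym/negbFE/eqP eqd] := eqVneq (d x i) (d (flip x j) i).
  (* Otherwise moving along [j] from [flip x i] would undo the move along [i] and return to [x],
     against injectivity of the cube map. *)
  case: (@flip_neq _ (flip x i) _ _ ij); rewrite flipK; apply: phif_inj => s.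
  by rewrite !dE -eqd addbK.
pose o : {ffun 'I_p -> bool} := [ffun => false].
have [d_const phifE] : (forall x i, d x i = d o i) /\
    (forall (x : {ffun 'I_p -> bool}) s, (s \in phi (f x)) =
      (s \in phi (f o)) (+) [exists i, x i && (s == d o i)]).
  (* Induction on the number of true coordinates: one more flip is made at each stage, and [d_flip]
     carries the labels along. *)
  suff H m (x : {ffun 'I_p -> bool}) : #|[set i | x i]| = m ->
    (forall i, d x i = d o i) /\
    (forall s, (s \in phi (f x)) =
      (s \in phi (f o)) (+) [exists i, x i && (s == d o i)]).
    by split=> x; case: (H _ x erefl).
  elim: m x => [x /eqP|m IHm x cx].
    rewrite cards_eq0 => /eqP/setP x0.
    have -> : x = o by apply/ffunP => i; move: (x0 i); rewrite !inE ffunE.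
    split=> // s; rewrite (_ : [exists i, _] = false) ?addbF //.
    by apply/existsP => -[i]; rewrite ffunE.
  have [i xi] : exists i, x i.
    have /card_gt0P[i] : (0 < #|[set i | x i]|)%N by rewrite cx.
    by rewrite inE; exists i.
  have [|dy fy] := IHm (flip x i).
    move: cx; rewrite (cardsD1 i) inE xi => -[<-].
    congr #|pred_of_set _|; apply/setP => j.
    by rewrite !inE ffunE; case: eqP => [->|_]; rewrite ?xi ?addbF.
  split=> [j|s]; rewrite -(flipK x i); first by rewrite d_flip.
  rewrite dE fy dy flipK -addbA; congr (_ (+) _).
  have [->|si] := eqVneq s (d o i).
    rewrite (_ : [exists j, _] = false).
      by apply/esym/existsP; exists i; rewrite xi eqxx.
    apply/existsP => -[j /andP[]]; rewrite ffunE => xj /eqP/d_inj ij.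
    by rewrite -ij eqxx xi in xj.
  rewrite addbF; apply: eq_existsb => j; rewrite ffunE.
  by case: eqP => [->|_]; rewrite ?addbF // (negbTE si) !andbF.
have memfd x i : (d o i \in phi (f x)) = (d o i \in phi (f o)) (+) x i.
  rewrite phifE; congr (_ (+) _); apply/existsP/idP => [|xi].
    by case=> j /andP[xj /eqP/d_inj ->].
  by exists i; rewrite xi eqxx.
pose B := [set d o i | i in 'I_p].
have memfN x t : t \notin B -> (t \in phi (f x)) = (t \in phi (f o)).
  move=> tB; rewrite phifE (_ : [exists i, _] = false) ?addbF //.
  apply/existsP => -[i /andP[_ /eqP ti]]; case/imsetP: tB; by exists i.
(* The face of [f o] need not be the lowest of the cube, so [top] switches on exactly the
   coordinates whose label is missing from it. *)
pose top : {ffun 'I_p -> bool} := [ffun i => d o i \notin phi (f o)].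
have Btop : B \subset phi (f top).
  by apply/subsetP => _ /imsetP[i _ ->]; rewrite memfd ffunE; case: (_ \in _).
exists (f top), B; split=> //; first by rewrite card_imset ?card_ord //; exact: d_inj.
apply/setP => u; apply/imsetP/(subcubeP _ Btop) => [[x _ ->] t tB|hu].
  by rewrite !memfN.
exists [ffun i => (d o i \in phi (f o)) (+) (d o i \in phi u)] => //.
apply/phi_inj/setP => t; have [/imsetP[i _ ->]|tB] := boolP (t \in B).
  by rewrite memfd ffunE addKb.
by rewrite hu // !memfN.
Qed.

(** The induced [p]-cubes correspond one-to-one to the pairs of a face and a [p]-element subset of
    it. *)
Lemma cube_count_complex p : cube_count e p = (\sum_(v : V) 'C(#|phi v|, p))%N.
Proof.
pose D := [set q : V * {set T} | (q.2 \subset phi q.1) && (#|q.2| == p)].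
rewrite /cube_count (_ : [set S | _] = (fun q => subcube q.1 q.2) @: D); last first.
  apply/setP => S; rewrite inE; apply/idP/imsetP => [/induces_subcube[v [B [Bv cB ->]]]|].
    by exists (v, B); rewrite ?inE /= ?Bv ?cB ?eqxx.
  by case=> -[v B]; rewrite inE /= => /andP[Bv /eqP <-] ->; exact: subcube_induces.
rewrite card_in_imset => [|[v B] [w C]]; last first.
  by rewrite !inE /= => /andP[Bv _] /andP[Cw _] /(subcube_inj Bv Cw)[-> ->].
under eq_bigr do rewrite -cards_draws -sum1dep_card.
by rewrite pair_big_dep -sum1dep_card.
Qed.

(** Coefficientwise this is the binomial theorem: a face with [m] elements tops ['C(m, p)] cubes of
    dimension [p]. *)
Lemma cube_poly_complex : cube_poly e = \sum_(v : V) (1 + 'X) ^+ #|phi v|.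
Proof.
apply/polyP => p; rewrite coef_cube_poly cube_count_complex coef_sum natr_sum.
apply: eq_bigr => v _; rewrite exprDn coef_sum.
under eq_bigr do rewrite expr1n mul1r coefMn coefXn.
have [le|lt] := leqP p #|phi v|.
  rewrite (bigD1 (Ordinal (le : p < #|phi v|.+1)%N)) //= eqxx big1 ?addr0 // => i.
  by rewrite -val_eqE /= eq_sym => /negbTE ->; rewrite mul0rn.
rewrite bin_small // big1 // => i _; rewrite gtn_eqF ?mul0rn //.
by rewrite (leq_ltn_trans _ lt) // -ltnS.
Qed.

End SimplicialCubes.

(** * Coefficients of power series and linear recurrences *)

Section PowerSeries.
Variable R : comNzRingType.
Implicit Types f : fps R.

Lemma fps_coefD f g n : fps_coef (f + g) n = fps_coef f n + fps_coef g n.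
Proof. by []. Qed.

Lemma fps_coefN f n : fps_coef (- f) n = - fps_coef f n.
Proof. by []. Qed.

Lemma fps_coef_natl m f n : fps_coef (m%:R * f) n = m%:R * fps_coef f n.
Proof.
by rewrite !mulr_natl; elim: m => [|m IHm]; rewrite ?mulr0n // !mulrS fps_coefD IHm.
Qed.

Lemma fps_coefCM c f n : fps_coef (fpsC c * f) n = c * fps_coef f n.
Proof.
rewrite [LHS]/= big_ord_recl subn0 big1 ?addr0 // => i _.
by rewrite mul0r.
Qed.

Lemma fps_coefXM0 f : fps_coef (fpsX * f) 0 = 0.
Proof. by rewrite [LHS]/= big_ord1 mul0r. Qed.

Lemma fps_coefXMS f n : fps_coef (fpsX * f) n.+1 = fps_coef f n.
Proof.
rewrite [LHS]/= 2!big_ord_recl /= mul0r add0r mul1r /bump /= subSS subn0.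
by rewrite big1 ?addr0 // => i _; rewrite mul0r.
Qed.

End PowerSeries.

(** The recurrence and its initial values say that the denominator times [FPS f] is 1, which also
    makes the denominator a unit. *)
Lemma fps_linear_recurrence (R : comUnitRingType) (k : nat) (b c : R) (f : nat -> R) :
    f 0 = 1 -> f 1 = k%:R + b ->
    (forall n, f n.+2 = (k%:R + b) * f n.+1 + c * f n) ->
  FPS f = 1 / (1 - k%:R * fpsX - fpsC b * fpsX - fpsC c * fpsX ^+ 2).
Proof.
move=> f0 f1 fS; set D := (X in 1 / X).
have DE : D * FPS f = 1.
  apply/fpsP => n; rewrite /D expr2 !mulrBl mul1r -!mulrA.
  rewrite !fps_coefD !fps_coefN fps_coef_natl !fps_coefCM.
  by case: n => [|[|n]]; rewrite ?fps_coefXMS ?fps_coefXM0 /= ?f0 ?f1 ?fS; ring.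
have uD : D \is a GRing.unit by apply/unitrPr; exists (FPS f).
by rewrite div1r -[RHS]mulr1 -DE mulKr.
Qed.

(** Stated for predicates and summands on plain sequences, so that functions defined by recursion on
    the word simplify after the split. *)
Lemma big_tuple_cons (T : finType) (M : nmodType) n
    (P : pred (seq T)) (F : seq T -> M) :
  \sum_(w : n.+1.-tuple T | P w) F w =
  \sum_(a : T) \sum_(w : n.-tuple T | P (a :: w)) F (a :: w).
Proof.
rewrite pair_big_dep /=.
rewrite (reindex (fun q : T * n.-tuple T => cons_tuple q.1 q.2)) //=.
exists (fun w : n.+1.-tuple T => (thead w, behead_tuple w)) => [[a w] _|w _] /=.
  by congr (_, _); apply: val_inj.
by rewrite [RHS]tuple_eta; apply: val_inj.
Qed.

(** * Parsing Pell strings from left to right *)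

Section PellWords.

Variable k : nat.
Hypothesis k_gt0 : (0 < k)%N.
Local Notation letter := 'I_k.+1.
Implicit Types (w u v s : seq letter) (a : letter) (b : bool).

Let ord0_max : (ord0 == ord_max :> letter) = false.
Proof. by rewrite -val_eqE /= eq_sym gtn_eqF. Qed.

(* [b] tells that the word is read just after the first letter of a pair kk. *)
Fixpoint pell_from b w : bool :=
  if w is a :: w' then
    if b then (a == ord_max) && pell_from false w' else pell_from (a == ord_max) w'
  else ~~ b.

(* Each pair kk becomes k0, so that the nonzero letters of the result are
   exactly the nonzero letters of the parse over {0, ..., k - 1, kk}. *)
Fixpoint pell_norm b w : seq letter :=
  if w is a :: w' then
    (if b then ord0 else a) :: pell_norm (~~ b && (a == ord_max)) w'
  else [::].

Lemma size_pell_norm b w : size (pell_norm b w) = size w.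
Proof. by elim: w b => //= a w IHw b; rewrite IHw. Qed.

(** Prepending a letter can only spoil the maximality of a run that starts at position 0. *)
Lemma maximal_runSS a w i j :
  maximal_run ord_max (a :: w) i.+1 j.+1 =
  maximal_run ord_max w i j && ((i == 0%N) ==> (a != ord_max)).
Proof.
rewrite /maximal_run /= !ltnS; case: i => [|i] /=; last by rewrite andbT.
rewrite (inj_eq Some_inj) -!andbA; do 3!congr (_ && _); exact: andbC.
Qed.

Lemma maximal_run0S a w j :
  maximal_run ord_max (a :: w) 0 j.+1 =
  (a == ord_max) &&
    (if j is 0 then onth w 0 != Some ord_max else maximal_run ord_max w 0 j).
Proof.
rewrite /maximal_run /= !ltnS !drop0; case: j => [|j] /=; first by rewrite take0 andbT.
by case: (a == _); rewrite ?andbF //=.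
Qed.

(** The flag is general so that the induction can pass inside a pair. In state [true] the initial
    run lacks the first letter of its pair, so it is nonempty and of odd length; all other runs are
    even. *)
Lemma pell_fromP b w :
  reflect ((forall i j, maximal_run ord_max w i j -> odd (j - i) = b && (i == 0%N))
           /\ (b -> onth w 0 = Some ord_max))
          (pell_from b w).
Proof.
elim: w b => [|a w IHw] b /=.
  apply: (iffP idP) => [/negbTE -> |[_]]; last by case: b => // /(_ isT).
  by split=> // i j /andP[/andP[]]; case: j.
have [->|a_max] := eqVneq a ord_max; last first.
  case: b => /=; first by constructor=> -[_ /(_ isT)[/eqP]]; rewrite (negbTE a_max).
  apply: (iffP (IHw false)) => -[h _]; split=> // i j.
    case: j => [/andP[/andP[]] //|j]; case: i => [|i].
      by rewrite maximal_run0S (negbTE a_max).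
    by rewrite maximal_runSS => /andP[/h]; rewrite subSS.
  by move=> hr; rewrite -subSS h // maximal_runSS hr a_max implybT.
(* In state [true] the leading [ord_max] closes a pair; in state [false], treated last, it opens
   one. *)
case: b => /=.
  apply: (iffP (IHw false)) => -[h h0]; split=> // i j.
    case: j => [/andP[/andP[]] //|j]; case: i => [|i].
      rewrite maximal_run0S eqxx /=; case: j => // j /h/=.
      by move=> ->.
    by rewrite maximal_runSS => /andP[/h]; rewrite subSS.
  case: i => [|i] hr.
    have := h 0%N j.+1; rewrite maximal_run0S eqxx /=.
    case: j hr => [/andP[/andP[]] //|j] hr /(_ hr).
    by rewrite /= negbK => ->.
  by rewrite -subSS h // maximal_runSS hr.
apply: (iffP (IHw true)) => -[h h0].
  split=> // i j.
  case: j => [/andP[/andP[]] //|j]; case: i => [|i].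
    case: j => [|j]; rewrite maximal_run0S eqxx; first by rewrite h0 ?eqxx.
    by move=> /h /= ->.
  by rewrite maximal_runSS eqxx implybF => /andP[/h]; rewrite subSS /= => -> /negbTE.
split=> [i j|_]; last first.
  (* If the next letter were not [ord_max], the first letter alone would be a maximal run of length
     1. *)
  apply/eqP/contraT => hw; have := h 0%N 1%N.
  by rewrite maximal_run0S eqxx hw => /(_ isT).
case: i => [|i] hr.
  have := h 0%N j.+1; rewrite maximal_run0S eqxx /=.
  by case: j hr => [/andP[/andP[]] //|j] hr /(_ hr)/negbFE.
by rewrite -subSS h // maximal_runSS hr.
Qed.

Lemma pell_stringE n (w : n.-tuple letter) : pell_string w = pell_from false w.
Proof.
apply/idP/pell_fromP => [/forallP h|[h _]].
  split=> // i j hr; have /andP[/andP[ltij lejn] _] := hr.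
  rewrite size_tuple -ltnS in lejn.
  have := forallP (h (Ordinal (ltn_trans ltij lejn))) (Ordinal lejn).
  by move=> /implyP/(_ hr)/negbTE.
apply/forallP => i; apply/forallP => j; apply/implyP => /h.
by rewrite /= => ->.
Qed.

(** The letters already read fix the state of the parse, and a 0 written in state [true] can only
    come from [ord_max]. *)
Lemma pell_norm_inj b u v : pell_from b u -> pell_from b v ->
  pell_norm b u = pell_norm b v -> u = v.
Proof.
elim: u b v => [|a u IHu] b [|c v] //=.
case: b => /=; first by move=> /andP[/eqP -> hu] /andP[/eqP -> hv] [/(IHu _ _ hu hv) ->].
by move=> hu hv [ac]; rewrite -ac in hv *; move=> /(IHu _ _ hu hv) ->.
Qed.

(** Erasing nonzero letters of a parse gives a parse again: this is downward closure. Just after an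
    erased opening [ord_max], the new word is in state [c = false] while the old one is in state
    [b = true]. *)
Lemma pell_norm_down b c w s : pell_from b w -> (c ==> b) -> size s = size w ->
    (forall i, nth ord0 s i = ord0 \/ nth ord0 s i = nth ord0 (pell_norm b w) i) ->
  exists u, [/\ size u = size w, pell_from c u & pell_norm c u = s].
Proof.
elim: w b c s => [|a w IHw] b c [|x s] //=.
  by move=> /negbTE ->; rewrite implybF => cF _ _; exists [::]; rewrite /= cF.
move=> hw cb [sz] hs; have hs' i := hs i.+1; move: (hs 0%N) => /= {hs}.
case: b hw cb hs' => /= [/andP[_ hw] _ hs'|hw cb hs'].
  move=> x0; have {x0} -> : x = ord0 by case: x0.
  have [u [szu hu <-]] := IHw _ false _ hw isT sz hs'.
  (* The second half of a pair becomes 0 when its first half was erased; in both cases it parses to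
     0. *)
  exists ((if c then ord_max else ord0) :: u).
  by case: c; rewrite /= szu ?eqxx ?ord0_max hu.
rewrite implybF in cb; rewrite (negbTE cb) => hx.
have imp : (x == ord_max) ==> (a == ord_max).
  by case: hx => ->; rewrite ?ord0_max ?implybb.
have [u [szu hu <-]] := IHw _ _ _ hw imp sz hs'.
by exists (x :: u); rewrite /= szu hu.
Qed.

Lemma pell_norm_eq0 b w i : nth ord0 w i = ord0 -> nth ord0 (pell_norm b w) i = ord0.
Proof. by elim: w b i => [|a w IHw] b [|i] //=; [case: b | exact: IHw]. Qed.

(** A 0 is never half of a pair, so putting a letter other than [ord_max] in its place leaves the
    rest of the parse unchanged. *)
Lemma pell_norm_replace_letter b w i a : pell_from b w -> (i < size w)%N ->
    nth ord0 w i = ord0 -> a != ord_max ->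
  pell_norm b (set_nth ord0 w i a) = set_nth ord0 (pell_norm b w) i a.
Proof.
move=> + + + /negbTE a_max; elim: w b i => [|x w IHw] b [|i] //=.
  by move=> + _ x0; rewrite x0 ord0_max; case: b => //= _; rewrite a_max.
by case: b => /= [/andP[_ hw]|hw] lti wi; rewrite IHw.
Qed.

(** The second letter of the new pair parses to 0, so changing two letters of the word changes only
    one letter of the parse. *)
Lemma pell_norm_replace_pair b w i : pell_from b w -> (i.+1 < size w)%N ->
    nth ord0 w i = ord0 -> nth ord0 w i.+1 = ord0 ->
  pell_norm b (set_nth ord0 (set_nth ord0 w i ord_max) i.+1 ord_max) =
  set_nth ord0 (pell_norm b w) i ord_max.
Proof.
elim: w b i => [|x w IHw] b [|i] //=; last first.
  by case: b => /= [/andP[_ hw]|hw] lti wi wi1; rewrite IHw.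
case: w {IHw} => [|y w] //= + _ x0 y0; rewrite x0 y0 ord0_max.
by case: b => //= _; rewrite eqxx.
Qed.

(** Converse of the two replacement lemmas: adding one nonzero letter to the parse is always
    realised by an edge move. *)
Lemma pell_norm_cover b u v i a : pell_from b u -> pell_from b v ->
    (i < size u)%N -> a != ord0 -> nth ord0 (pell_norm b u) i = ord0 ->
    pell_norm b v = set_nth ord0 (pell_norm b u) i a ->
  nth ord0 u i = ord0 /\
  (if a == ord_max then
     [/\ (i.+1 < size u)%N, nth ord0 u i.+1 = ord0
       & v = set_nth ord0 (set_nth ord0 u i ord_max) i.+1 ord_max]
   else v = set_nth ord0 u i a).
Proof.
elim: u b v i => [|x u IHu] b [|y v] [|i] //=.
- case: b => /= [_ _ _ /eqP na _ [/esym] //|hu hv _ na x0 [yE]].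
  rewrite x0 ord0_max in hu *; rewrite yE in hv * => vE; split=> //.
  (* If [a] is [ord_max], then [v] continues with the closing [ord_max], whose parse 0 forces the
     next letter of [u] to be 0. *)
  move: hv vE; case: eqP => [-> hv|_ hv /(pell_norm_inj hv hu) -> //].
  case: v hv => [|z v] //= /andP[/eqP -> hv].
  case: u hu {IHu} => [|z' u] //= hu [z0]; rewrite -z0 ord0_max in hu *.
  by move=> /(pell_norm_inj hv hu) ->.
case: b => /= [/andP[/eqP -> hu] /andP[/eqP -> hv]|hu hv] lti na ui.
  by case=> /(IHu _ _ _ hu hv lti na ui)[ui0]; case: ifP => _ => [[? ? ->]|->].
case=> yx; rewrite yx in hv * => /(IHu _ _ _ hu hv lti na ui)[ui0].
by case: ifP => _ => [[? ? ->]|->].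
Qed.

(** Each pair counts once, so this is the cardinality of the face attached to the word. *)
Definition pell_rank b w : nat := count (predC1 ord0) (pell_norm b w).

Definition pell_sum b n : {poly int} :=
  \sum_(w : n.-tuple letter | pell_from b w) (1 + 'X) ^+ pell_rank b w.

Lemma pell_sum0 b : pell_sum b 0 = (~~ b)%:R.
Proof.
rewrite /pell_sum; case: b.
  by rewrite big_pred0 // => w; rewrite tuple0.
rewrite (eq_bigl (pred1 [tuple])) => [|w]; first by rewrite big_pred1_eq.
by rewrite [w]tuple0 /= eqxx.
Qed.

Lemma pell_sumTS n : pell_sum true n.+1 = pell_sum false n.
Proof.
rewrite [LHS](big_tuple_cons n (pell_from true)
  (fun w => (1 + 'X) ^+ pell_rank true w)) /= (bigD1 ord_max) //= eqxx /= [X in _ + X]big1 ?addr0.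
  by apply: eq_bigr => w _; rewrite /pell_rank /= add0n.
by move=> a /negbTE na; rewrite big_pred0 // => w; rewrite na.
Qed.

(** The first letter is 0, with weight 1, or one of the [k - 1] letters strictly between 0 and
    [ord_max], with weight [1 + 'X], or it opens a pair of weight [1 + 'X]. *)
Lemma pell_sumFS n : pell_sum false n.+1 =
  (k%:R + (k%:R - 1) * 'X) * pell_sum false n + (1 + 'X) * pell_sum true n.
Proof.
rewrite [LHS](big_tuple_cons n (pell_from false)
  (fun w => (1 + 'X) ^+ pell_rank false w)) /= (bigD1 ord_max) //= (bigD1 ord0) /=; last by rewrite ord0_max.
rewrite eqxx ord0_max addrC; congr (_ + _); last first.
  rewrite mulr_sumr; apply: eq_bigr => w _; rewrite /pell_rank /= eqxx.
  by rewrite eq_sym ord0_max /= add1n exprS.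
rewrite [X in _ + X](eq_bigr (fun=> (1 + 'X) * pell_sum false n)) => [|a]; last first.
  move=> /andP[/negbTE am a0]; rewrite am /pell_sum mulr_sumr; apply: eq_bigr => w _.
  by rewrite /pell_rank /= am a0 add1n exprS.
rewrite sumr_const (_ : #|_| = k.-1); last first.
  have := cardC (pred2 ord_max (ord0 : letter)).
  rewrite card_ord card2 eq_sym ord0_max /= add2n => -[ck].
  apply: succn_inj; rewrite prednK // -[RHS]ck; congr _.+1.
  by apply: eq_card => a; rewrite !inE negb_or.
rewrite (eq_bigr (fun w : n.-tuple letter => (1 + 'X) ^+ pell_rank false w)); last first.
  by move=> w _; rewrite /pell_rank /= ord0_max.
have kE : k%:R = k.-1%:R + 1 :> {poly int} by rewrite natr1 prednK.
by rewrite -/(pell_sum false n) kE -mulr_natl; ring.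
Qed.

End PellWords.

(** * The Munarini graph as the face graph of a simplicial complex *)

Section MunariniComplex.

Variables n k : nat.
Hypothesis k_gt0 : (0 < k)%N.
Local Notation letter := 'I_k.+1.
Implicit Types u v w : munarini_vertex n k.

Definition vertex_norm w : seq letter := pell_norm false (val w).

(** Positions are kept with their letters, so that exchanging one nonzero letter for another changes
    two elements and is not an edge. *)
Definition vertex_support w : {set 'I_n * letter} :=
  [set q : 'I_n * letter | (q.2 != ord0) && (nth ord0 (vertex_norm w) q.1 == q.2)].

Lemma vertex_pell w : pell_from false (val w).
Proof. by rewrite -pell_stringE (valP w). Qed.

Lemma size_vertex_norm w : size (vertex_norm w) = n.
Proof. by rewrite size_pell_norm size_tuple. Qed.

Lemma eq_vertex_norm_nth u v (i : 'I_n) :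
    (forall a, ((i, a) \in vertex_support u) = ((i, a) \in vertex_support v)) ->
  nth ord0 (vertex_norm u) i = nth ord0 (vertex_norm v) i.
Proof.
move=> h; have [u0|u0] := eqVneq (nth ord0 (vertex_norm u) i) ord0; last first.
  by move: (h (nth ord0 (vertex_norm u) i)); rewrite !inE /= u0 eqxx => /esym/eqP.
move: (h (nth ord0 (vertex_norm v) i)); rewrite !inE /= eqxx andbT.
by case: eqP => [->|_ /eqP].
Qed.

Lemma vertex_support_inj : injective vertex_support.
Proof.
move=> u v /setP uv; apply/val_inj/val_inj/(pell_norm_inj (vertex_pell u) (vertex_pell v)).
apply: (@eq_from_nth _ ord0); first by rewrite !size_vertex_norm.
move=> i; rewrite size_vertex_norm => ltin.
by apply: (@eq_vertex_norm_nth u v (Ordinal ltin)) => a; rewrite uv.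
Qed.

Lemma vertex_support_down v (B : {set 'I_n * letter}) :
  B \subset vertex_support v -> exists u, vertex_support u = B.
Proof.
move=> /subsetP Bv.
pose s := [seq (if (i, nth ord0 (vertex_norm v) i) \in B
                then nth ord0 (vertex_norm v) i else ord0) | i : 'I_n <- enum 'I_n].
have sE (i : 'I_n) : nth ord0 s i = if (i, nth ord0 (vertex_norm v) i) \in B
                then nth ord0 (vertex_norm v) i else ord0.
  by rewrite (nth_map i) ?nth_ord_enum ?size_enum_ord.
have [||i|u [szu hu nu]] := pell_norm_down k_gt0 (c := false) (s := s) (vertex_pell v).
- by [].
- by rewrite size_map size_enum_ord size_tuple.
- have [ltin|lein] := ltnP i n; last first.
    by left; rewrite nth_default // size_map size_enum_ord.
  by rewrite (sE (Ordinal ltin)); case: ifP; [right | left].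
rewrite size_tuple in szu; move/eqP: szu => szu.
have pu : pell_string (Tuple szu) by rewrite pell_stringE.
exists (Sub (Tuple szu) pu); apply/setP => -[i a].
rewrite inE /= /vertex_norm SubK nu sE.
apply/andP/idP => [[a0]|iaB].
  by case: ifP => [iB /eqP <- //|_ /eqP ea]; rewrite ea eqxx in a0.
move: (Bv _ iaB); rewrite inE /= => /andP[a0 /eqP ea].
by rewrite a0 ea iaB eqxx.
Qed.

Lemma support_set_norm u v (i : 'I_n) a : a != ord0 ->
    nth ord0 (vertex_norm u) i = ord0 ->
    vertex_norm v = set_nth ord0 (vertex_norm u) i a ->
  forall q, (q \in vertex_support v) = (q \in vertex_support u) (+) (q == (i, a)).
Proof.
move=> a0 ui0 vE [j c]; rewrite !inE vE nth_set_nth /= xpair_eqE.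
rewrite (inj_eq val_inj); have [->|_] := eqVneq j i; last by rewrite addbF.
rewrite ui0 /= [ord0 == c]eq_sym andNb /= [a == c]eq_sym.
by have [->|_] := eqVneq c a; rewrite ?a0 ?andbF.
Qed.

Lemma replace_support u v :
    replace_letter (val u) (val v) || replace_pair (val u) (val v) ->
  exists t, forall s,
    (s \in vertex_support v) = (s \in vertex_support u) (+) (s == t).
Proof.
case/orP => /existsP[i] /existsP[a].
  case/and3P => /andP[a_gt0 a_ltk]; rewrite (tnth_nth ord0) => /eqP ui /eqP vE.
  exists (i, a); apply: support_set_norm.
  - by rewrite -val_eqE /= -lt0n.
  - exact: pell_norm_eq0.
  - rewrite /vertex_norm vE pell_norm_replace_letter ?vertex_pell ?size_tuple //.
    by rewrite -val_eqE /= ltn_eqF.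
case/and4P => /eqP ai; rewrite !(tnth_nth ord0) => /eqP ui /eqP ua /eqP vE.
exists (i, ord_max); apply: support_set_norm.
- by rewrite -val_eqE /= -lt0n.
- exact: pell_norm_eq0.
rewrite /vertex_norm vE ai.
by rewrite pell_norm_replace_pair ?vertex_pell ?size_tuple -?ai.
Qed.

(** Adding one element to the face turns one 0 of the parse into a nonzero letter, so
    [pell_norm_cover] applies. *)
Lemma support_replace u v t : t \notin vertex_support u ->
    (forall s, (s \in vertex_support v) = (s \in vertex_support u) (+) (s == t)) ->
  replace_letter (val u) (val v) || replace_pair (val u) (val v).
Proof.
case: t => i a tu h.
have: (i, a) \in vertex_support v by rewrite h eqxx (negbTE tu).
rewrite inE /= => /andP[a0 /eqP vi].
have ui : nth ord0 (vertex_norm u) i = ord0.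
  (* A nonzero letter here would differ from [a], hence survive in [v], whose parse has [a] at this
     position. *)
  apply/eqP/contraT => ui; have := h (i, nth ord0 (vertex_norm u) i).
  rewrite !inE /= ui eqxx vi xpair_eqE eqxx /= eq_sym.
  by case: eqP.
have vE : vertex_norm v = set_nth ord0 (vertex_norm u) i a.
  apply: (@eq_from_nth _ ord0).
    by rewrite size_set_nth !size_vertex_norm; apply/esym/maxn_idPr.
  move=> j; rewrite size_vertex_norm => ltjn; rewrite nth_set_nth /=.
  case: eqP => [->|/eqP ji]; first exact: vi.
  apply: (@eq_vertex_norm_nth v u (Ordinal ltjn)) => c.
  by rewrite h xpair_eqE -val_eqE /= (negbTE ji) addbF.
have ltiu : (i < size (val (val u)))%N by rewrite size_tuple.
have [ui0] := pell_norm_cover k_gt0 (vertex_pell u) (vertex_pell v) ltiu a0 ui vE.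
case: eqP => [_ [lti1 ui1 vE']|/eqP am vE']; apply/orP; [right|left].
  rewrite size_tuple in lti1; apply/existsP; exists i; apply/existsP; exists (Ordinal lti1).
  by rewrite !(tnth_nth ord0) /= ui0 ui1 vE' !eqxx.
apply/existsP; exists i; apply/existsP; exists a.
apply/and3P; split; [|by rewrite (tnth_nth ord0) ui0|exact/eqP].
rewrite lt0n -[_ != 0%N]/(a != ord0) a0 /= ltn_neqAle -ltnS ltn_ord andbT.
by rewrite -[k in _ != k]/(val (ord_max : letter)) val_eqE.
Qed.

Lemma munarini_adjP u v :
  reflect (exists t, forall s,
             (s \in vertex_support v) = (s \in vertex_support u) (+) (s == t))
          (munarini_adj u v).
Proof.
apply: (iffP idP) => [|[t ht]].
  rewrite /munarini_adj => /or4P[] r; try by apply: replace_support; rewrite r ?orbT.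
    have [|t ht] := @replace_support v u; first by rewrite r.
    by exists t => s; rewrite ht addbK.
  have [|t ht] := @replace_support v u; first by rewrite r orbT.
  by exists t => s; rewrite ht addbK.
(* Membership of [t] tells which endpoint is the smaller face, hence in which direction the
   replacement is read. *)
have [tu|tu] := boolP (t \in vertex_support u).
  rewrite munarini_sym; have tv : t \notin vertex_support v by rewrite ht tu eqxx.
  have /orP[|] := support_replace tv (fun s => esym (canLR (addbK _) (ht s)));
    by rewrite /munarini_adj => ->; rewrite ?orbT.
by have /orP[|] := support_replace tu ht; rewrite /munarini_adj => ->; rewrite ?orbT.
Qed.

Lemma card_vertex_support w : #|vertex_support w| = pell_rank false (val w).
Proof.
rewrite /pell_rank -sum1_count (big_nth ord0) big_mkord.
rewrite [size _]size_vertex_norm sum1dep_card.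
rewrite -(card_imset _ (f := fun i : 'I_n => (i, nth ord0 (vertex_norm w) i))).
  apply: eq_card => -[i a]; rewrite inE /=.
  apply/andP/imsetP => [[a0 /eqP ea]|[j]]; first by exists i; rewrite ?inE /= ?ea.
  by rewrite inE /= => j0 [-> ->].
by move=> i j [].
Qed.

Lemma munarini_cube_polyE : munarini_cube_poly n k = pell_sum k false n.
Proof.
rewrite /munarini_cube_poly.
rewrite (cube_poly_complex vertex_support_inj vertex_support_down munarini_adjP).
rewrite /pell_sum -(eq_bigl _ _ (@pell_stringE k n)).
rewrite [RHS](reindex_omap (val : munarini_vertex n k -> _) insub); last first.
  by move=> w pw; rewrite insubT.
rewrite (eq_bigl (fun w : munarini_vertex n k => true)) => [|w]; last first.
  by rewrite (valP w) valK eqxx.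
by apply: eq_bigr => w _; rewrite card_vertex_support.
Qed.

End MunariniComplex.

Theorem theorem4p4 (k : nat) (hk : (1 <= k)%N) :
  FPS (fun n => munarini_cube_poly n k) =
  1 / (1 - k%:R * fpsX - fpsC ((k%:R - 1) * 'X) * fpsX - fpsC (1 + 'X) * fpsX ^+ 2)
    :> fps {poly int}.
Proof.
(* The sum for state [true] is the sum for state [false] one letter shorter; eliminating it leaves a
   recurrence of order two. *)
apply: fps_linear_recurrence => [||n]; rewrite !munarini_cube_polyE //.
- by rewrite pell_sum0.
- by rewrite pell_sumFS // !pell_sum0 mulr1 mulr0 addr0.
- by rewrite pell_sumFS // pell_sumTS.
Qed.
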